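(* Let $M$ be a partially ordered monoid with a family of null sequences $Z(M)$, let $(X,d_{X,M},Z(M))$ be a Hausdorff equipped dislocated $M$-distance space, let $f\colon X\to X$ be weakly orbitally continuous, and let $\{\lambda_n\}_{n\in\mathbb{N}}$ be a sequence of non-decreasing operators $\lambda_n\colon M_+\to M_+$. Put $\prod_{i=1}^n\lambda_i:=\lambda_1\circ\lambda_2\circ\dots\circ\lambda_n$. Suppose that $x_0\in X$ is such that one of the following two sets of conditions (I) or (II) holds: (I) (a) $(X,d_{X,M},Z(M))$ is $\mathcal{H}$-complete; (b) the orbit $O(f,x_0)$ is bounded; (c) for any $\alpha\in M_+$ one has $\left\{\left(\prod_{i=1}^n\lambda_i\right)(\alpha)\right\}\in Z(M)$; (d) for each $n\in\mathbb{N}$ and $x,y\in O_n(f,x_0)$ there exist $x',y'\in O_{n-1}(f,x_0)$ such that $d_{X,M}(x,y)\le\lambda_n(d_{X,M}(x',y'))$. (II) (a) $(X,d_{X,M},Z(M))$ is $\mathcal{W}$-complete; (b) for any $n\in\mathbb{N}$, $d_{X,M}(f^n(x_0),f^{n+1}(x_0))\le\lambda_n(d_{X,M}(f^{n-1}(x_0),f^n(x_0)))$; (c) $\left\{\left(\prod_{i=1}^n\lambda_i\right)(d_{X,M}(x_0,f(x_0)))\right\}\in\mathcal{CS}$. Then $f$ has a fixed point. The fixed point is unique provided the following set of conditions (III) holds: (III) (a) for any $\alpha\in M_+$ one has $\left\{\left(\prod_{i=1}^n\lambda_i\right)(\alpha)\right\}\in Z(M)$; (b) for arbitrary $u,v\in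 X$, each $n\in\mathbb{N}$ and arbitrary $x\in O_n(f,u)$, $y\in O_n(f,v)$, there exist $x'\in O_{n-1}(f,u)$ and $y'\in O_{n-1}(f,v)$ such that $d_{X,M}(x,y)\le\lambda_n(d_{X,M}(x',y'))$; (c) for arbitrary $u,v\in X$ the set $\{d_{X,M}(x,y): x\in O(f,u),\ y\in O(f,v)\}$ is bounded.
   Context: A partially ordered monoid is a monoid $(M,+,\theta_M)$ (associative operation $+$, neutral element $\theta_M$; not assumed commutative) with a partial order $\le$ such that $x_1\le y_1$, $x_2\le y_2$ imply $x_1+x_2\le y_1+y_2$, and $M_+:=\{x\in M:\theta_M\le x\}\ne\{\theta_M\}$. A set $N\subset M_+$ is bounded if there is $m\in M$ with $n\le m$ for all $n\in N$. A family of null sequences $Z(M)$ is a family of sequences of elements of $M_+$ such that: (1) the constant sequence $\{\theta_M\}$ is in $Z(M)$, and if $x\in M_+$ and the constant sequence $\{x\}$ is in $Z(M)$ then $x=\theta_M$; (2) $\{x_n\},\{y_n\}\in Z(M)$ implies $\{x_n+y_n\}\in Z(M)$; (3) if $\{x_n\}\in Z(M)$ and $\theta_M\le y_n\le x_n$ for all $n$, then $\{y_n\}\in Z(M)$; (4) each subsequence of a sequence in $Z(M)$ is in $Z(M)$. $\mathcal{CS}$ denotes the set of sequences $\{x_n\}$ in $M_+$ whose series is a Cauchy series, i.e. for all increasing sequences of natural numbers $\{n_k\},\{m_k\}$ with $m_k\ge n_k$ for all $k$ one has $\{\sum_{s=n_k}^{m_k}x_s\}_k\in Z(M)$. A dislocated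 $M$-valued distance on a set $X$ is a mapping $d_{X,M}\colon X\times X\to M_+$ with $d_{X,M}(x,y)=d_{X,M}(y,x)$ for all $x,y$ and such that $d_{X,M}(x,y)=\theta_M$ implies $x=y$. Together with a chosen family $Z(M)$ it forms an equipped dislocated $M$-distance space $(X,d_{X,M},Z(M))$. A sequence $\{x_n\}\subset X$ converges to $x\in X$ ($x_n\to x$) if $\{d_{X,M}(x_n,x)\}\in Z(M)$. The space is Hausdorff if each converging sequence has a unique limit. A sequence $\{x_n\}\subset X$ is Cauchy if for all increasing sequences of natural numbers $\{n_k\},\{m_k\}$ with $m_k>n_k$ for all $k$ one has $\{d_{X,M}(x_{n_k},x_{m_k})\}\in Z(M)$; the space is $\mathcal{H}$-complete if each Cauchy sequence converges to an element of $X$. $\mathcal{CW}$ is the family of sequences $\{x_n\}\subset X$ with $\{d_{X,M}(x_n,x_{n+1})\}\in\mathcal{CS}$; the space is $\mathcal{W}$-complete if each sequence in $\mathcal{CW}$ converges to an element of $X$. $f^n$ is the $n$-th iterate of $f$, $f^0=\mathrm{id}$. $O_n(f,x_0):=\{f^n(x_0),f^{n+1}(x_0),\dots\}$ for $n\ge0$ and $O(f,x_0):=O_0(f,x_0)$. The orbit $O(f,x_0)$ is bounded if the set $\{d_{X,M}(f^n(x_0),f^m(x_0)): n,m\ge0\}$ is bounded. $f$ is weakly orbitally continuous if for $x,a\in X$, $f^n(x)\to a$ implies $f(a)=a$. An operator $\lambda\colon M_+\to M_+$ is non-decreasing if $a\le b$ implies $\lambda(a)\le\lambda(b)$.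
   Formalization: The product of λ_1,…,λ_n is taken with λ_1 acting first, i.e. λ_n∘…∘λ_1, in (I), (II) and (III); with the usual reading of λ_1∘…∘λ_n (λ_n acting first) the existence of a fixed point fails. *)

(* Defs.v *)
(* MathComp world; sets and boundedness come from mathcomp-classical. *)
From HB Require Import structures.
From mathcomp Require Import all_boot all_order.
From mathcomp Require Import boolp classical_sets.

Set Implicit Arguments.
Unset Strict Implicit.
Unset Printing Implicit Defensive.

Import Order.TTheory.

Local Open Scope classical_set_scope.
Local Open Scope order_scope.
Local Open Scope group_scope.

(* The monoid is written multiplicatively, since the additive structures of the
   library are all commutative: [x * y] is x + y, [1] is the neutral element
   theta_M, and [\prod] is the ordered finite sum. The positive cone M_+ is the
   set of x with [1 <= x]. *)
HB.mixin Record isPOMonoid (d : Order.disp_t) M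
    of Order.POrder d M & Monoid M := {
  le_mulg : forall x1 y1 x2 y2 : M, x1 <= y1 -> x2 <= y2 -> x1 * x2 <= y1 * y2;
  cone_nontrivial : [set x : M | (1 : M) <= x] <> [set 1]
}.

#[short(type="poMonoidType")]
HB.structure Definition POMonoid (d : Order.disp_t) :=
  {M of isPOMonoid d M & Order.POrder d M & Monoid M}.

(* Strictly increasing: index sequences extracting subsequences. *)
Definition increasing (u : nat -> nat) := {homo u : i j / (i < j)%N}.

(* Sequences are indexed from 0; a sequence {x_n} with n >= 1 is encoded by
   [fun n => x n.+1]. *)
Section NullSequences.
Context {d : Order.disp_t} {M : poMonoidType d}.

Record null_family (Z : set (nat -> M)) : Prop := NullFamily {
  null_ge1 : forall x, Z x -> forall n, 1 <= x n;
  null_cst1 : Z (fun=> 1);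
  null_cst_eq1 : forall x : M, 1 <= x -> Z (fun=> x) -> x = 1;
  null_mul : forall x y, Z x -> Z y -> Z (fun n => x n * y n);
  null_le : forall x y, Z x -> (forall n, 1 <= y n <= x n) -> Z y;
  null_subseq : forall x u, Z x -> increasing u -> Z (x \o u)
}.

Definition cauchy_series (Z : set (nat -> M)) : set (nat -> M) :=
  [set x | (forall n, 1 <= x n) /\
    forall n m : nat -> nat, increasing n -> increasing m ->
      (forall k, (n k <= m k)%N) ->
      Z (fun k => \prod_(n k <= s < (m k).+1) x s)].

(* The values of the [lam n] outside the positive cone, and [lam 0], are
   irrelevant. *)
Definition nondecreasing_operators (lam : nat -> M -> M) :=
  forall n, (0 < n)%N ->
    (forall a : M, 1 <= a -> 1 <= lam n a) /\
    (forall a b : M, 1 <= a -> a <= b -> lam n a <= lam n b).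

(* The composite of lam_1, ..., lam_n in diagrammatic order, i.e.
   [f \; g] is x |-> g (f x): the operator lam_1 acts first, so that
   [prod_op lam n a = lam n (... (lam 1 a))]. This is the composite produced by
   iterating d(f^n x, f^(n+1) x) <= lam_n (d(f^(n-1) x, f^n x)). With lam_1
   acting last the fixed point theorem fails: on the reals take lam_1 t = 0 for
   t <= 1 and t otherwise, lam_n = 1 for n >= 2, and the successor map on nat,
   with d(x, x) = 0 and distances 1 between distinct points, except
   d(0, 1) = d(1, 2) = 2; all of (II) holds and no point is fixed. *)
Definition prod_op (lam : nat -> M -> M) (n : nat) : M -> M :=
  \big[(fun f g => f \; g)/id]_(1 <= i < n.+1) lam i.

End NullSequences.

Section DistanceSpaces.
Context {d : Order.disp_t} {M : poMonoidType d} {X : Type}.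

Record dislocated_distance (dist : X -> X -> M) : Prop := DislocatedDistance {
  dist_ge1 : forall x y, 1 <= dist x y;
  dist_sym : forall x y, dist x y = dist y x;
  dist_eq1 : forall x y, dist x y = 1 -> x = y
}.

Context (dist : X -> X -> M) (Z : set (nat -> M)).

Definition converges (x : nat -> X) (a : X) := Z (fun n => dist (x n) a).

Definition hausdorff := forall x a b, converges x a -> converges x b -> a = b.

Definition cauchy_seq (x : nat -> X) :=
  forall n m : nat -> nat, increasing n -> increasing m ->
    (forall k, (n k < m k)%N) -> Z (fun k => dist (x (n k)) (x (m k))).

Definition H_complete := forall x, cauchy_seq x -> exists a, converges x a.

Definition CW : set (nat -> X) :=
  [set x | cauchy_series Z (fun n => dist (x n) (x n.+1))].

Definition W_complete := forall x, CW x -> exists a, converges x a.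

Definition orbit_from (f : X -> X) (n : nat) (x : X) : set X :=
  [set iter k f x | k in [set k | (n <= k)%N]].

Definition weakly_orbitally_continuous (f : X -> X) :=
  forall x a, converges (fun n => iter n f x) a -> f a = a.

Definition conditions_I (f : X -> X) (lam : nat -> M -> M) (x0 : X) :=
  [/\ H_complete,
      has_ubound [set t | exists n m, t = dist (iter n f x0) (iter m f x0)],
      (forall a : M, 1 <= a -> Z (fun n => prod_op lam n.+1 a)) &
      forall n x y, (0 < n)%N -> orbit_from f n x0 x -> orbit_from f n x0 y ->
        exists x' y', [/\ orbit_from f n.-1 x0 x', orbit_from f n.-1 x0 y' &
          dist x y <= lam n (dist x' y')]].

Definition conditions_II (f : X -> X) (lam : nat -> M -> M) (x0 : X) :=
  [/\ W_complete,
      (forall n, (0 < n)%N ->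
        dist (iter n f x0) (iter n.+1 f x0)
          <= lam n (dist (iter n.-1 f x0) (iter n f x0))) &
      cauchy_series Z (fun n => prod_op lam n.+1 (dist x0 (f x0)))].

Definition conditions_III (f : X -> X) (lam : nat -> M -> M) :=
  [/\ (forall a : M, 1 <= a -> Z (fun n => prod_op lam n.+1 a)),
      (forall u v n x y, (0 < n)%N ->
        orbit_from f n u x -> orbit_from f n v y ->
        exists x' y', [/\ orbit_from f n.-1 u x', orbit_from f n.-1 v y' &
          dist x y <= lam n (dist x' y')]) &
      forall u v, has_ubound [set t | exists x y,
        [/\ orbit_from f 0 u x, orbit_from f 0 v y & t = dist x y]]].

End DistanceSpaces.

(* Main.v *)
(* Iterating the contraction inequality bounds the distances occurring after
   [n] steps by [prod_op lam n alpha]. The orbit is therefore Cauchy under (I)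
   and in CW under (II), and weak orbital continuity makes its limit a fixed
   point. Under (III) the distance of two fixed points is dominated by a null
   sequence, so it is the neutral element.
   A null family need not be stable under changing finitely many terms, and the
   null sequences in the hypotheses start at [n = 1], so that they say nothing
   about distances from [x0] itself. Both completeness arguments are therefore
   applied to the orbit of [f x0]. *)
Require Import Defs.
From HB Require Import structures.
From mathcomp Require Import all_boot all_order.
From mathcomp Require Import boolp classical_sets.

Set Implicit Arguments.
Unset Strict Implicit.
Unset Printing Implicit Defensive.

Import Order.TTheory.

Section Auxiliary.
Local Open Scope order_scope.
Local Open Scope group_scope.

Context {d : Order.disp_t} {M : poMonoidType d}.

Lemma mulg_ge1 (x y : M) : 1 <= x -> 1 <= y -> 1 <= x * y.
Proof. by move=> hx hy; rewrite -[leLHS]mulg1; exact: le_mulg. Qed.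

Lemma prodg_ge1 (x : nat -> M) (r : seq nat) :
  (forall n, 1 <= x n) -> 1 <= \prod_(s <- r) x s.
Proof.
move=> x1; elim: r => [|i r IHr]; first by rewrite big_nil.
by rewrite big_cons mulg_ge1.
Qed.

Lemma le_prodg (x y : nat -> M) (r : seq nat) :
  (forall n, x n <= y n) -> \prod_(s <- r) x s <= \prod_(s <- r) y s.
Proof.
move=> xy; elim: r => [|i r IHr]; first by rewrite !big_nil.
by rewrite !big_cons le_mulg.
Qed.

Lemma cauchy_series_le (Z : set (nat -> M)) (x y : nat -> M) :
  null_family Z -> cauchy_series Z x -> (forall n, 1 <= y n <= x n) ->
  cauchy_series Z y.
Proof.
move=> hZ [_ hx] hyx.
have y1 n : 1 <= y n by case/andP: (hyx n).
have yx n : y n <= x n by case/andP: (hyx n).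
split=> // n m hn hm nm.
by apply: (null_le hZ (hx n m hn hm nm)) => k; rewrite prodg_ge1 ?le_prodg.
Qed.

Lemma prod_op0 (lam : nat -> M -> M) (a : M) : prod_op lam 0 a = a.
Proof. by rewrite /prod_op big_geq. Qed.

Lemma prod_opS (lam : nat -> M -> M) (n : nat) (a : M) :
  prod_op lam n.+1 a = lam n.+1 (prod_op lam n a).
Proof.
(* The big operator needs [\;] to be a monoid law; associativity and
   neutrality hold definitionally. *)
pose law := Monoid.isLaw.Build (M -> M) id (fun f g => f \; g)
  (fun _ _ _ => erefl) (fun _ => erefl) (fun _ => erefl).
pose comp_law : Monoid.law id := HB.pack (fun f g : M -> M => f \; g) law.
by rewrite /prod_op (big_nat_recr (op := comp_law)).
Qed.

Lemma le_prod_op (lam : nat -> M -> M) (P : nat -> set M) (alpha : M) :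
  nondecreasing_operators lam ->
  (forall n t, P n t -> 1 <= t) ->
  (forall t, P 0 t -> t <= alpha) ->
  (forall n t, P n.+1 t -> exists2 t', P n t' & t <= lam n.+1 t') ->
  forall n t, P n t -> t <= prod_op lam n alpha.
Proof.
move=> hlam P1 P0 PS; elim=> [|n IHn] t Pt; first by rewrite prod_op0 P0.
have [t' Pt' tt'] := PS _ _ Pt.
have [_ lam_mono] := hlam n.+1 isT.
by rewrite prod_opS (le_trans tt')// lam_mono ?IHn ?(P1 _ _ Pt').
Qed.

Context {X : Type} (dist : X -> X -> M) (Z : set (nat -> M)).
Hypotheses (hZ : null_family Z) (hdist : dislocated_distance dist).
Context (f : X -> X) (lam : nat -> M -> M).
Hypothesis hlam : nondecreasing_operators lam.

Lemma orbit_cauchy (x0 : X) :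
  conditions_I dist Z f lam x0 -> cauchy_seq dist Z (fun n => iter n f (f x0)).
Proof.
move=> [_ [alpha ub] hnull hcontr] n m hn hm nm.
have alpha1 : 1 <= alpha.
  by apply: le_trans (dist_ge1 hdist x0 x0) _; apply: ub; exists 0, 0.
pose P k := [set t | exists x y,
  [/\ orbit_from f k x0 x, orbit_from f k x0 y & t = dist x y]]%classic.
have P_le : forall k t, P k t -> t <= prod_op lam k alpha.
  apply: le_prod_op => //
    [k _ [x [y [_ _ ->]]]|_ [_ [_ [[i _ <-] [j _ <-] ->]]]
    |k _ [x [y [hx hy ->]]]].
  - exact: dist_ge1.
  - by apply: ub; exists i, j.
  - have [x' [y' [hx' hy' le_xy]]] := hcontr k.+1 x y isT hx hy.
    by exists (dist x' y') => //; exists x', y'.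
apply: (null_le hZ (null_subseq hZ (hnull _ alpha1) hn)) => k /=.
rewrite (dist_ge1 hdist) P_le//.
exists (iter (n k).+1 f x0), (iter (m k).+1 f x0); rewrite -!iterSr.
by split=> //; [exists (n k).+1|exists (m k).+1] => //=; rewrite ltnS ltnW.
Qed.

Lemma orbit_CW (x0 : X) :
  conditions_II dist Z f lam x0 -> CW dist Z (fun n => iter n f (f x0)).
Proof.
move=> [_ hcontr hCS]; apply: cauchy_series_le hCS _ => // n.
rewrite (dist_ge1 hdist) -!iterSr.
apply: (le_prod_op
  (P := fun k => [set dist (iter k f x0) (iter k.+1 f x0)]%classic))
  => // [k _ ->|_ ->|k _ ->] //.
- exact: dist_ge1.
- by exists (dist (iter k f x0) (iter k.+1 f x0)) => //; exact: hcontr.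
Qed.

Lemma orbit_from_fixed (n : nat) (a x : X) :
  f a = a -> orbit_from f n a x -> x = a.
Proof. by move=> fa [k _ <-]; rewrite iter_fix. Qed.

Lemma fixed_point_unique (a b : X) :
  conditions_III dist Z f lam -> f a = a -> f b = b -> a = b.
Proof.
move=> [hnull hcontr hbnd] fa fb; have [alpha ub] := hbnd a b.
have ab_alpha : dist a b <= alpha.
  by apply: ub; exists a, b; split=> //; exists 0.
have ab1 := dist_ge1 hdist a b.
have ab_le n : dist a b <= prod_op lam n alpha.
  apply: (le_prod_op (P := fun=> [set dist a b]%classic)) => //
    [k _ ->//|_ ->//|k _ ->].
  have ha : orbit_from f k.+1 a a
    by exists k.+1 => //=; exact: (iter_fix k.+1 fa).
  have hb : orbit_from f k.+1 b b
    by exists k.+1 => //=; exact: (iter_fix k.+1 fb).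
  have [x [y [hx hy]]] := hcontr a b k.+1 a b isT ha hb.
  rewrite (orbit_from_fixed fa hx) (orbit_from_fixed fb hy).
  by exists (dist a b).
apply: (dist_eq1 hdist); apply: (null_cst_eq1 hZ) => //.
apply: (null_le hZ (hnull _ (le_trans ab1 ab_alpha))) => n.
by rewrite ab1 ab_le.
Qed.

End Auxiliary.

Theorem theorem3 (d : Order.disp_t) (M : poMonoidType d)
    (Z : set (nat -> M)) (hZ : null_family Z)
    (X : Type) (dist : X -> X -> M) (hdist : dislocated_distance dist)
    (hH : hausdorff dist Z)
    (f : X -> X) (hf : weakly_orbitally_continuous dist Z f)
    (lam : nat -> M -> M) (hlam : nondecreasing_operators lam)
    (x0 : X)
    (hx0 : conditions_I dist Z f lam x0 \/ conditions_II dist Z f lam x0) :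
  (exists a, f a = a) /\
  (conditions_III dist Z f lam -> forall a b, f a = a -> f b = b -> a = b).
Proof.
split; last by move=> hIII a b; exact: (fixed_point_unique hZ hdist hlam hIII).
suff [a /hf fa] : exists a, converges dist Z (fun n => iter n f (f x0)) a.
  by exists a.
case: hx0 => h.
- by case: (h) => complete _ _ _; apply/complete/(orbit_cauchy hZ hdist hlam h).
- by case: (h) => complete _ _; apply/complete/(orbit_CW hZ hdist hlam h).
Qed.
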